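(* Let $G$ be a group, let $\mathbb{F}$ be a field, and let $\mathcal{A}$ be a finite $G$-graded associative $\mathbb{F}$-algebra such that $J_G(\mathcal{A})=\{0\}$. Then $\mathcal{A}$ is critical as a $G$-graded algebra if and only if $\mathcal{A}$ is $G$-graded simple.
   Context: Algebras are associative $\mathbb{F}$-algebras, not necessarily unital. A $G$-graded algebra is an algebra $\mathcal{A}=\bigoplus_{g\in G}\mathcal{A}_g$ with $\mathcal{A}_g\mathcal{A}_h\subseteq\mathcal{A}_{gh}$; a subspace $W$ is graded if $W=\bigoplus_g(W\cap\mathcal{A}_g)$. Graded right $\mathcal{A}$-modules are right modules $M=\bigoplus_g M_g$ with $M_g\mathcal{A}_h\subseteq M_{gh}$; $M$ is $G$-graded simple if $M\mathcal{A}\ne\{0\}$ and $M$ has no nonzero proper graded submodule. The graded Jacobson radical $J_G(\mathcal{A})$ is the intersection of the annihilators $\{a\in\mathcal{A}: xa=0\ \forall x\in M\}$ over all $G$-graded simple right $\mathcal{A}$-modules $M$ (so it is $\mathcal{A}$ if there are none). $\mathcal{A}$ is $G$-graded simple ($G$-simple) if $\mathcal{A}^2\neq\{0\}$ and its only $G$-graded two-sided ideals are $\{0\}$ and $\mathcal{A}$. Let $\mathbb{F}\langle X_G\rangle$ be the free associative algebra (without constant terms) on variables $x_i^{(g)}$, $i\ge1$, $g\in G$, with $\deg x_i^{(g)}=g$. A polynomial $f(x_1^{(g_1)},\dots,x_k^{(g_k)})$ is a graded identity of $\mathcal{A}$ if $f(a_1,\dots,a_k)=0$ for all $a_i\in\mathcal{A}_{g_i}$.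 A variety of $G$-graded algebras is the class of all $G$-graded algebras satisfying a given set of graded identities; the variety generated by a class of graded algebras is the one defined by their common graded identities. A graded section of $\mathcal{A}$ is a quotient $\mathcal{B}/\mathcal{C}$, with $\mathcal{B}$ a $G$-graded subalgebra of $\mathcal{A}$ and $\mathcal{C}$ a $G$-graded ideal of $\mathcal{B}$; it is proper unless $\mathcal{B}=\mathcal{A}$ and $\mathcal{C}=0$. A $G$-graded algebra is critical if it is finite and does not belong to the variety generated by its proper graded sections. *)

(* Defs.v *)
From HB Require Import structures.
From mathcomp Require Import all_boot all_order all_algebra.
From mathcomp Require Import boolp classical_sets functions cardinality.
From mathcomp Require Import finmap monalg.

Set Implicit Arguments.
Unset Strict Implicit.
Unset Printing Implicit Defensive.

Import GRing.Theory.

Local Open Scope classical_set_scope.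
Local Open Scope ring_scope.

Section GradedSpaces.
Variables (G : groupType) (F : fieldType) (V : lmodType F).
Implicit Types (W : set V) (Vg : G -> set V).

Definition subspace W : Prop := submod_closed (mem W).

(* The internal direct sum W = (+)_g Vg g; G may be infinite, so elements
   of the sum are finite sums of elements of distinct summands. *)
Definition direct_sum W Vg : Prop :=
  [/\ forall g, subspace (Vg g),
      forall w, W w <-> exists (s : seq G) (v : G -> V),
        [/\ uniq s, forall g, Vg g (v g) & w = \sum_(g <- s) v g]
    & forall (s : seq G) (v : G -> V), uniq s -> (forall g, Vg g (v g)) ->
        \sum_(g <- s) v g = 0 -> {in s, forall g, v g = 0}].

Definition graded_subspace Vg W : Prop :=
  subspace W /\ direct_sum W (fun g => W `&` Vg g).

End GradedSpaces.

(* MathComp's rings are unital, so the product is bundled by hand. *)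
Record gradedAlgType (G : groupType) (F : fieldType) := GradedAlg {
  alg_sort :> lmodType F;
  alg_mul : alg_sort -> alg_sort -> alg_sort;
  alg_mulA : associative alg_mul;
  alg_mulDl : left_distributive alg_mul +%R;
  alg_mulDr : right_distributive alg_mul +%R;
  alg_scaleAl : forall (c : F) x y, c *: alg_mul x y = alg_mul (c *: x) y;
  alg_scaleAr : forall (c : F) x y, c *: alg_mul x y = alg_mul x (c *: y);
  alg_comp : G -> set alg_sort;
  alg_direct : direct_sum [set: alg_sort] alg_comp;
  alg_compM : forall g h x y, alg_comp g x -> alg_comp h y ->
    alg_comp (g * h)%g (alg_mul x y)
}.

Notation "x '*a' y" := (alg_mul x y) (at level 40, left associativity).

Record gradedModType (G : groupType) (F : fieldType) (A : gradedAlgType G F)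
    := GradedMod {
  mod_sort :> lmodType F;
  mod_act : mod_sort -> A -> mod_sort;
  mod_actA : forall m a b, mod_act m (a *a b) = mod_act (mod_act m a) b;
  mod_actDl : forall m n a, mod_act (m + n) a = mod_act m a + mod_act n a;
  mod_actDr : forall m a b, mod_act m (a + b) = mod_act m a + mod_act m b;
  mod_scaleAl : forall (c : F) m a, c *: mod_act m a = mod_act (c *: m) a;
  mod_scaleAr : forall (c : F) m a, c *: mod_act m a = mod_act m (c *: a);
  mod_comp : G -> set mod_sort;
  mod_direct : direct_sum [set: mod_sort] mod_comp;
  mod_compM : forall g h m a, mod_comp g m -> alg_comp h a ->
    mod_comp (g * h)%g (mod_act m a)
}.

Section Notions.
Variables (G : groupType) (F : fieldType) (A : gradedAlgType G F).

Definition graded_submodule (M : gradedModType A) (N : set M) : Prop :=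
  graded_subspace (@mod_comp _ _ _ M) N /\
  forall m a, N m -> N (mod_act m a).

Definition graded_simple_module (M : gradedModType A) : Prop :=
  (exists (m : M) (a : A), mod_act m a != 0) /\
  forall N : set M, graded_submodule N -> N = [set 0] \/ N = [set: M].

Definition module_annihilator (M : gradedModType A) : set A :=
  [set a | forall m : M, mod_act m a = 0].

Definition graded_jacobson_radical : set A :=
  [set a | forall M : gradedModType A,
     graded_simple_module M -> module_annihilator M a].

Definition graded_subalgebra (B : set A) : Prop :=
  graded_subspace (@alg_comp _ _ A) B /\
  forall x y, B x -> B y -> B (x *a y).

Definition graded_ideal_of (B C : set A) : Prop :=
  [/\ C `<=` B, graded_subspace (@alg_comp _ _ A) C
    & forall b c, B b -> C c -> C (b *a c) /\ C (c *a b)].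

Definition graded_simple : Prop :=
  (exists x y : A, x *a y != 0) /\
  forall I : set A, graded_ideal_of [set: A] I -> I = [set 0] \/ I = [set: A].

End Notions.

Arguments graded_jacobson_radical {G F} A.
Arguments graded_simple {G F} A.

Section Identities.
Variables (G : groupType) (F : fieldType).

(* The letter (i, g) is the variable x_i^(g). *)
Definition free_word : Type := {fmonom (nat * G)%type}.

(* F<X_G> is the set of noncommutative polynomials without constant term. *)
Definition free_alg : set {malg F[free_word]} := [set f | f@_mone = 0].

Variable A : gradedAlgType G F.

(* The product a_1 *a ... *a a_k; the value 0 on the empty word is never
   used by elements of free_alg. *)
Definition eval_word (a : nat * G -> A) (w : free_word) : A :=
  if fmonom_val w is x :: w' then foldl (fun p y => p *a a y) (a x) w' else 0.

Definition eval_poly (a : nat * G -> A) (f : {malg F[free_word]}) : A :=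
  \sum_(w <- msupp f) f@_w *: eval_word a w.

Definition graded_identity (f : {malg F[free_word]}) : Prop :=
  free_alg f /\
  forall a : nat * G -> A, (forall x, alg_comp x.2 (a x)) -> eval_poly a f = 0.

End Identities.

Record graded_section (G : groupType) (F : fieldType) (A : gradedAlgType G F)
    := GradedSection {
  sec_num : set A;
  sec_den : set A;
  sec_numP : graded_subalgebra sec_num;
  sec_denP : graded_ideal_of sec_num sec_den
}.

Definition proper_section (G : groupType) (F : fieldType)
    (A : gradedAlgType G F) (s : graded_section A) : Prop :=
  ~ (sec_num s = [set: A] /\ sec_den s = [set 0]).

(* The quotient B / C of a graded section, with (B / C)_g the image of
   B `&` A_g. *)
Section SectionAlgebra.
Variables (G : groupType) (F : fieldType) (A : gradedAlgType G F).
Variable s : graded_section A.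
Local Notation B := (sec_num s).
Local Notation C := (sec_den s).

Lemma sec_num_submod : submod_closed (mem B).
Proof. by case: (sec_numP s) => -[]. Qed.

Lemma sec_den_submod : submod_closed (mem C).
Proof. by case: (sec_denP s) => _ []. Qed.

Definition num_pred : {pred A} := fun x => x \in B.
HB.instance Definition _ :=
  GRing.isSubmodClosed.Build F A num_pred sec_num_submod.

Definition num_space : Type := {x : A | num_pred x}.
HB.instance Definition _ := SubChoice.on num_space.
HB.instance Definition _ := [SubChoice_isSubLmodule of num_space by <:].

Lemma num_valP (x : num_space) : B (val x).
Proof. exact: set_mem (valP x). Qed.

Definition num_mk (x : A) (Bx : B x) : num_space := Sub x (mem_set Bx).

Definition num_mul (x y : num_space) : num_space :=
  num_mk ((sec_numP s).2 _ _ (num_valP x) (num_valP y)).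

Lemma num_val0 : val (0 : num_space) = 0.
Proof. by []. Qed.

Lemma num_valD (x y : num_space) : val (x + y) = val x + val y.
Proof. exact: raddfD. Qed.

Lemma num_valZ (c : F) (x : num_space) : val (c *: x) = c *: val x.
Proof. by rewrite linearZ. Qed.

Lemma num_mulE x y : val (num_mul x y) = val x *a val y.
Proof. by []. Qed.

Definition den_pred : {pred num_space} := fun x => val x \in C.

Lemma den_submod : submod_closed den_pred.
Proof.
case: sec_den_submod => C0 CD; split=> [|c x y Cx Cy].
  by rewrite unfold_in num_val0.
by rewrite unfold_in num_valD num_valZ; apply: CD.
Qed.
HB.instance Definition _ :=
  GRing.isSubmodClosed.Build F num_space den_pred den_submod.

Local Open Scope quotient_scope.

Definition sec_space : Type := Quotient.quot den_pred.
HB.instance Definition _ := GRing.Zmodule.on sec_space.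

Definition sec_pi (x : num_space) : sec_space := \pi_(Quotient.quot den_pred) x.

Lemma sec_pi_surj (q : sec_space) : exists x, q = sec_pi x.
Proof. by exists (repr (q : Quotient.quot den_pred)); rewrite /sec_pi reprK. Qed.

Lemma sec_piP x y : sec_pi x = sec_pi y <-> C (val x - val y).
Proof.
rewrite -raddfB; split=> [/eqP|Cxy].
  by rewrite -Quotient.idealrBE => /set_mem.
by apply/eqP; rewrite -Quotient.idealrBE; apply: mem_set.
Qed.

Lemma sec_piD x y : sec_pi (x + y) = sec_pi x + sec_pi y.
Proof. exact: Quotient.pi_add. Qed.

Lemma sec_pi0 : sec_pi 0 = 0.
Proof. by apply: (addrI (sec_pi 0)); rewrite -sec_piD !addr0. Qed.

Lemma sec_pi_eq0 x : sec_pi x = 0 <-> C (val x).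
Proof. by rewrite -sec_pi0 sec_piP num_val0 subr0. Qed.

Definition sec_scale (c : F) (q : sec_space) : sec_space :=
  sec_pi (c *: repr (q : Quotient.quot den_pred)).
Definition sec_mul (p q : sec_space) : sec_space :=
  sec_pi (num_mul (repr (p : Quotient.quot den_pred))
                  (repr (q : Quotient.quot den_pred))).

Lemma sec_reprP x : C (val (repr (sec_pi x : Quotient.quot den_pred)) - val x).
Proof. by apply/sec_piP; rewrite /sec_pi reprK. Qed.

Lemma den_scale c x : C x -> C (c *: x).
Proof.
case: sec_den_submod => C0 CD Cx; rewrite -[_ *: _]addr0.
by apply/set_mem/CD; [exact: mem_set|].
Qed.

Lemma den_add x y : C x -> C y -> C (x + y).
Proof.
case: sec_den_submod => C0 CD Cx Cy; rewrite -[x]scale1r.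
by apply/set_mem/CD; exact: mem_set.
Qed.

Lemma sec_piZ c x : sec_pi (c *: x) = sec_scale c (sec_pi x).
Proof.
apply/esym/sec_piP; rewrite !num_valZ -scalerBr.
exact/den_scale/sec_reprP.
Qed.

Lemma alg_mulBl (x y z : A) : (x - y) *a z = x *a z - y *a z.
Proof. by rewrite alg_mulDl -scaleN1r -alg_scaleAl scaleN1r. Qed.

Lemma alg_mulBr (x y z : A) : x *a (y - z) = x *a y - x *a z.
Proof. by rewrite alg_mulDr -scaleN1r -alg_scaleAr scaleN1r. Qed.

Lemma sec_piM x y : sec_pi (num_mul x y) = sec_mul (sec_pi x) (sec_pi y).
Proof.
apply/esym/sec_piP; rewrite !num_mulE.
set x' := repr _; set y' := repr _.
have -> : val x' *a val y' - val x *a val y =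
    val x' *a (val y' - val y) + (val x' - val x) *a val y.
  by rewrite alg_mulBr alg_mulBl addrA subrK.
case: (sec_denP s) => _ _ CM.
by apply: den_add; [apply: (CM _ _ (num_valP _) _).1
                   |apply: (CM _ _ (num_valP _) _).2]; apply: sec_reprP.
Qed.

Lemma sec_scalerA a b q : sec_scale a (sec_scale b q) = sec_scale (a * b) q.
Proof. by have [x ->] := sec_pi_surj q; rewrite -!sec_piZ scalerA. Qed.
Lemma sec_scale1r : left_id 1 sec_scale.
Proof. by move=> q; have [x ->] := sec_pi_surj q; rewrite -!sec_piZ scale1r. Qed.
Lemma sec_scalerDr : right_distributive sec_scale +%R.
Proof.
move=> c p q; have [x ->] := sec_pi_surj p; have [y ->] := sec_pi_surj q.
by rewrite -sec_piD -!sec_piZ scalerDr sec_piD.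
Qed.
Lemma sec_scalerDl q : {morph sec_scale^~ q : a b / a + b}.
Proof.
by move=> a b; have [x ->] := sec_pi_surj q; rewrite -!sec_piZ scalerDl sec_piD.
Qed.
HB.instance Definition _ := GRing.Zmodule_isLmodule.Build F sec_space
  sec_scalerA sec_scale1r sec_scalerDr sec_scalerDl.

Lemma sec_mulA : associative sec_mul.
Proof.
move=> p q r; have [x ->] := sec_pi_surj p; have [y ->] := sec_pi_surj q.
have [z ->] := sec_pi_surj r; rewrite -!sec_piM; congr sec_pi.
by apply: val_inj; rewrite !num_mulE alg_mulA.
Qed.
Lemma sec_mulDl : left_distributive sec_mul +%R.
Proof.
move=> p q r; have [x ->] := sec_pi_surj p; have [y ->] := sec_pi_surj q.
have [z ->] := sec_pi_surj r; rewrite -sec_piD -!sec_piM -sec_piD; congr sec_pi.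
by apply: val_inj; rewrite num_valD !num_mulE num_valD alg_mulDl.
Qed.
Lemma sec_mulDr : right_distributive sec_mul +%R.
Proof.
move=> p q r; have [x ->] := sec_pi_surj p; have [y ->] := sec_pi_surj q.
have [z ->] := sec_pi_surj r; rewrite -sec_piD -!sec_piM -sec_piD; congr sec_pi.
by apply: val_inj; rewrite num_valD !num_mulE num_valD alg_mulDr.
Qed.
Lemma sec_scaleAl (c : F) (p q : sec_space) :
  c *: sec_mul p q = sec_mul (c *: p) q.
Proof.
have [x ->] := sec_pi_surj p; have [y ->] := sec_pi_surj q.
rewrite -sec_piM -[LHS]sec_piZ -[X in sec_mul X _]sec_piZ -sec_piM.
by congr sec_pi; apply: val_inj; rewrite num_valZ !num_mulE num_valZ alg_scaleAl.
Qed.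
Lemma sec_scaleAr (c : F) (p q : sec_space) :
  c *: sec_mul p q = sec_mul p (c *: q).
Proof.
have [x ->] := sec_pi_surj p; have [y ->] := sec_pi_surj q.
rewrite -sec_piM -[LHS]sec_piZ -[X in sec_mul _ X]sec_piZ -sec_piM.
by congr sec_pi; apply: val_inj; rewrite num_valZ !num_mulE num_valZ alg_scaleAr.
Qed.

Definition sec_comp (g : G) : set sec_space :=
  [set sec_pi x | x in [set x : num_space | alg_comp g (val x)]].

Lemma sec_compM g h p q :
  sec_comp g p -> sec_comp h q -> sec_comp (g * h)%g (sec_mul p q).
Proof.
move=> [x gx <-] [y hy <-]; exists (num_mul x y); last exact: sec_piM.
exact: alg_compM.
Qed.

Lemma sec_pi_sum (r : seq G) (v : G -> num_space) :
  sec_pi (\sum_(g <- r) v g) = \sum_(g <- r) sec_pi (v g).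
Proof. exact: (big_morph sec_pi sec_piD sec_pi0). Qed.

Lemma sum_extend (V : zmodType) (r r' : seq G) (v : G -> V) :
  uniq r -> uniq r' -> {subset r <= r'} ->
  \sum_(g <- r') (if g \in r then v g else 0) = \sum_(g <- r) v g.
Proof.
move=> ur ur' rr'; rewrite -big_mkcond -big_filter; apply: perm_big.
apply: uniq_perm => //; first exact: filter_uniq.
by move=> g; rewrite mem_filter andb_idr // => /rr'.
Qed.

Lemma sec_direct : direct_sum [set: sec_space] sec_comp.
Proof.
have [Asub _ Aind] := alg_direct A; split.
- move=> g; have [A0 AD] := Asub g; split.
    apply: mem_set; exists 0; last exact: sec_pi0.
    exact: set_mem.
  move=> c p q /set_mem[x gx <-] /set_mem[y gy <-]; apply: mem_set.
  exists (c *: x + y); last by rewrite sec_piD sec_piZ.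
  rewrite /mkset num_valD num_valZ; apply/set_mem/AD; exact: mem_set.
- move=> q; split=> // _; have [x ->] := sec_pi_surj q.
  have [[_ [_ Bspan _]] _] := sec_numP s.
  have [/(_ (num_valP x)) [r [v [ur vB xE]]] _] := Bspan (val x).
  pose v' g := num_mk (vB g).1; exists r, (sec_pi \o v'); split=> //.
    by move=> g; exists (v' g) => //=; exact: (vB g).2.
  rewrite -sec_pi_sum; congr sec_pi; apply: val_inj.
  by rewrite raddf_sum.
- move=> r v ur vC.
  have [x xP] : {x : G -> num_space &
      forall g, alg_comp g (val (x g)) /\ sec_pi (x g) = v g}.
    apply: (@boolp.choice _ _ (fun g y => alg_comp g (val y) /\ sec_pi y = v g)).
    by move=> g; have [y gy <-] := vC g; exists y.
  under eq_bigr => g _ do rewrite -(xP g).2.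
  rewrite -sec_pi_sum => /sec_pi_eq0; rewrite raddf_sum /= => xC.
  have [_ [_ [Csub Cspan _]] _] := sec_denP s.
  have [/(_ xC)[r' [c [ur' cC cE]]] _] := Cspan (\sum_(g <- r) val (x g)).
  have A0 h : alg_comp h (0 : A) by have [/set_mem] := Asub h.
  pose t := undup (r ++ r').
  pose u g : A := (- 1) *: (if g \in r' then c g else 0) +
    (if g \in r then val (x g) else 0).
  have /Aind : uniq t by exact: undup_uniq.
  have uA g : alg_comp g (u g).
    have [_ AD] := Asub g; apply/set_mem/AD; apply: mem_set.
      by case: ifP => // _; exact: (cC g).2.
    by case: ifP => // _; exact: (xP g).1.
  move=> /(_ u uA); rewrite big_split /= -scaler_sumr !sum_extend ?undup_uniq //;
    last 2 first.
  + by move=> g gr; rewrite mem_undup mem_cat gr.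
  + by move=> g gr; rewrite mem_undup mem_cat gr orbT.
  rewrite cE scaleN1r addNr => /(_ erefl) u0 g gr.
  rewrite -(xP g).2; apply/sec_pi_eq0.
  have /u0 : g \in t by rewrite mem_undup mem_cat gr.
  rewrite /u gr scaleN1r addrC => /subr0_eq ->.
  by case: ifP => _; [exact: (cC g).1|exact: set_mem sec_den_submod.1].
Qed.

Definition section_alg : gradedAlgType G F :=
  @GradedAlg G F sec_space sec_mul sec_mulA sec_mulDl sec_mulDr
    sec_scaleAl sec_scaleAr sec_comp sec_direct sec_compM.

End SectionAlgebra.

Section Varieties.
Variables (G : groupType) (F : fieldType).

Definition variety (S : set {malg F[free_word G]}) : gradedAlgType G F -> Prop :=
  fun A => forall f, S f -> graded_identity A f.

Definition common_identities (K : gradedAlgType G F -> Prop) :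
    set {malg F[free_word G]} :=
  [set f | free_alg f /\ forall A, K A -> graded_identity A f].

Definition variety_generated (K : gradedAlgType G F -> Prop) :=
  variety (common_identities K).

End Varieties.

Definition proper_sections (G : groupType) (F : fieldType)
    (A : gradedAlgType G F) : gradedAlgType G F -> Prop :=
  fun S => exists2 s : graded_section A, proper_section s & S = section_alg s.

Definition critical (G : groupType) (F : fieldType)
    (A : gradedAlgType G F) : Prop :=
  finite_set [set: A] /\ ~ variety_generated (proper_sections A) A.

(* Main.v *)
Require Import Defs.
From mathcomp Require Import all_boot all_algebra.
From mathcomp Require Import boolp classical_sets cardinality.
From mathcomp Require Import finmap monalg.

Set Implicit Arguments.
Unset Strict Implicit.
Unset Printing Implicit Defensive.

Import GRing.Theory.

Local Open Scope classical_set_scope.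
Local Open Scope ring_scope.

(** Suppose first that the finite algebra [A] is critical with zero radical.
    Some polynomial is an identity of all proper quotients [A / I] but has a
    nonzero value [h] in [A], and this [h] lies in every nonzero graded ideal
    ([critical_monolith]). As the radical is zero, some graded simple module
    [M] is not killed by [h]; its annihilator is a graded ideal without [h],
    hence zero, so [M] is faithful. A finite algebra with a faithful graded
    simple module is graded simple: for a nonzero graded ideal [I] and finitely
    many homogeneous elements of [M], every [a] in [A] acts on them like some
    [c] in [I] ([graded_ideal_acts_fully]), and when these elements have zero
    common annihilator this gives [a = c].

    Conversely, suppose that [A] is finite and graded simple, and fix a
    homogeneous valuation [e] in finitely many letters at which polynomials take
    every value in [A]. Each valuation [b] of these letters in a proper section [s] has a
    kernel in the free algebra. Its image under [e] is a graded ideal of [A]; if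
    that ideal were zero, [A] would be a quotient of a subalgebra of a strictly
    smaller algebra. So every such kernel is mapped onto [A]
    ([section_kernel_evaluates_onto]). There are only finitely many of these
    kernels, and since [A * A] is nonzero their intersection is still mapped
    onto [A] ([eval_ideal_inter_onto]). A member of the intersection with
    nonzero value is an identity of all proper sections but not of [A]. *)

(** * Graded subspaces *)

Section Subspaces.
Variables (F : fieldType) (V : lmodType F).
Implicit Types W : set V.

Lemma subspace_intro W :
  W 0 -> (forall x y, W x -> W y -> W (x + y)) ->
  (forall c x, W x -> W (c *: x)) -> subspace W.
Proof.
move=> W0 WD WZ; split=> [|c x y /set_mem Wx /set_mem Wy]; apply: mem_set=> //.
by apply: WD => //; apply: WZ.
Qed.

Lemma subspace0 W : subspace W -> W 0.
Proof. by case=> /set_mem. Qed.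

Lemma subspaceD W x y : subspace W -> W x -> W y -> W (x + y).
Proof.
case=> _ WD Wx Wy; rewrite -[x]scale1r.
by apply/set_mem/WD; apply: mem_set.
Qed.

Lemma subspaceZ W c x : subspace W -> W x -> W (c *: x).
Proof.
move=> WS Wx; have /set_mem W0 := WS.1; case: WS => _ WD.
by rewrite -[_ *: _]addr0; apply/set_mem/WD; apply: mem_set.
Qed.

Lemma subspaceB W x y : subspace W -> W x -> W y -> W (x - y).
Proof.
move=> WS Wx Wy; apply: subspaceD => //.
by rewrite -scaleN1r; apply: subspaceZ.
Qed.

Lemma subspace_sum W (I : Type) (r : seq I) (P : pred I) (v : I -> V) :
  subspace W -> (forall i, P i -> W (v i)) -> W (\sum_(i <- r | P i) v i).
Proof.
move=> WS Wv; elim/big_ind: _ => //; first exact: subspace0.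
by move=> x y; apply: subspaceD.
Qed.

Lemma subspace_cap W W' : subspace W -> subspace W' -> subspace (W `&` W').
Proof.
move=> WS WS'; apply: subspace_intro.
- by split; apply: subspace0.
- by move=> x y [? ?] [? ?]; split; apply: subspaceD.
- by move=> c x [? ?]; split; apply: subspaceZ.
Qed.

End Subspaces.

Lemma sum_by_degree (G I : eqType) (V : nmodType) (r : seq I) (d : I -> G)
    (v : I -> V) :
  \sum_(i <- r) v i =
  \sum_(g <- undup (map d r)) \sum_(i <- r | d i == g) v i.
Proof.
rewrite (exchange_big_dep predT) //=; apply: eq_big_seq => i ir.
rewrite -big_filter (_ : [seq _ <- _ | _] = [:: d i]) ?big_seq1 //.
rewrite (eq_filter (a2 := pred1 (d i))); last by move=> g; rewrite /= eq_sym.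
by rewrite filter_pred1_uniq ?undup_uniq // mem_undup map_f.
Qed.

Section GradedSubspaces.
Variables (G : groupType) (F : fieldType) (V : lmodType F) (Vg : G -> set V).
Hypothesis V_direct : direct_sum [set: V] Vg.
Implicit Types W : set V.

Lemma comp_subspace g : subspace (Vg g). Proof. by case: V_direct. Qed.

Lemma homogeneous_decomposition x : exists (s : seq G) (v : G -> V),
  [/\ uniq s, forall g, Vg g (v g) & x = \sum_(g <- s) v g].
Proof. by case: V_direct => _ span _; apply/span. Qed.

(** Acting on a homogeneous module element of degree [k] translates degrees by
    [k]; since translation is injective on [G], the translated summands still
    lie in distinct components, hence are independent. *)
Lemma shifted_components_eq0 (k : G) (s : seq G) (v : G -> V) :
  uniq s -> (forall g, Vg (k * g)%g (v g)) -> \sum_(g <- s) v g = 0 ->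
  {in s, forall g, v g = 0}.
Proof.
move=> us vV vs0 g gs; case: V_direct => _ _ ind.
have := ind [seq (k * g)%g | g <- s] (fun h => v (k^-1 * h)%g).
rewrite (map_inj_uniq (@mulgI _ k)) big_map.
under eq_bigr => h _ do rewrite mulKg.
move=> /(_ us _ vs0 (k * g)%g (map_f _ gs)); rewrite mulKg; apply.
by move=> h; have := vV (k^-1 * h)%g; rewrite mulgA mulgV mul1g.
Qed.

(** Spanning by homogeneous elements suffices because several generators of
    the same degree can be added up into a single component, and independence
    of the components is inherited from the ambient space. *)
Lemma graded_subspace_of_homogeneous_sums W : subspace W ->
  (forall w, W w -> exists (I : eqType) (r : seq I) (d : I -> G) (v : I -> V),
     (forall i, i \in r -> W (v i) /\ Vg (d i) (v i)) /\
     w = \sum_(i <- r) v i) ->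
  graded_subspace Vg W.
Proof.
move=> WS Wgen; split=> //; split.
- by move=> g; apply: subspace_cap => //; apply: comp_subspace.
- move=> w; split=> [Ww|[s [v [_ vW ->]]]]; last first.
    by apply: subspace_sum => // g _; have [] := vW g.
  have [I [r [d [v [vP ->]]]]] := Wgen _ Ww.
  exists (undup (map d r)), (fun g => \sum_(i <- r | d i == g) v i); split.
  + exact: undup_uniq.
  + move=> g; rewrite big_seq_cond; split; apply: subspace_sum => //.
    * by move=> i /andP[/vP[]].
    * exact: comp_subspace.
    * by move=> i /andP[/vP[_ ?] /eqP <-].
  + exact: sum_by_degree.
- move=> s v us vW; have [_ _ ind] := V_direct.
  by apply: ind => // g; have [] := vW g.
Qed.

Lemma graded_subspace_of_components W : subspace W ->
  (forall s (v : G -> V), uniq s -> (forall g, Vg g (v g)) ->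
     W (\sum_(g <- s) v g) -> {in s, forall g, W (v g)}) ->
  graded_subspace Vg W.
Proof.
move=> WS Wcomp; apply: graded_subspace_of_homogeneous_sums => // w Ww.
have [s [v [us vV wE]]] := homogeneous_decomposition w.
exists G, s, id, v; split=> // g gs; split; last exact: vV.
by apply: (Wcomp s) => //; rewrite -wE.
Qed.

(** The decomposition of an element of [W] inside [W] is also a decomposition
    in the ambient space, and those are unique. *)
Lemma graded_component W s (v : G -> V) : graded_subspace Vg W -> uniq s ->
  (forall g, Vg g (v g)) -> W (\sum_(g <- s) v g) -> {in s, forall g, W (v g)}.
Proof.
move=> [WS [_ span _]] us vV Wv g gs.
have [/(_ Wv)[t [u [ut uW E]]] _] := span (\sum_(g <- s) v g).
pose x g := (if g \in s then v g else 0) - (if g \in t then u g else 0).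
have V0 h : Vg h 0 by apply: subspace0; apply: comp_subspace.
suff : x g = 0.
  rewrite /x gs => /subr0_eq ->; case: ifP => _; last exact: subspace0.
  by have [] := uW g.
have [_ _ ind] := V_direct.
apply: (ind (undup (s ++ t))); rewrite ?undup_uniq ?mem_undup ?mem_cat ?gs //.
  move=> h; apply: subspaceB; first exact: comp_subspace.
    by case: ifP.
  by case: ifP => // _; have [] := uW h.
rewrite big_split /= sumrN !sum_extend ?undup_uniq //.
- by rewrite E subrr.
- by move=> h ht; rewrite mem_undup mem_cat ht orbT.
- by move=> h hs; rewrite mem_undup mem_cat hs.
Qed.

Lemma graded_subspace_cap W W' : graded_subspace Vg W ->
  graded_subspace Vg W' -> graded_subspace Vg (W `&` W').
Proof.
move=> gW gW'; have [[WS _] [WS' _]] := (gW, gW').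
apply: graded_subspace_of_components; first exact: subspace_cap.
move=> s v us vV [Wv Wv'] g gs; split.
  exact: (graded_component gW us vV).
exact: (graded_component gW' us vV).
Qed.

Lemma graded_subspace_setT : graded_subspace Vg [set: V].
Proof.
apply: graded_subspace_of_components => //; exact: subspace_intro.
Qed.

End GradedSubspaces.
(** * Graded simple modules *)

Section Modules.
Variables (G : groupType) (F : fieldType) (A : gradedAlgType G F).
Variable M : gradedModType A.
Implicit Types (a x : A) (m : M) (R : set A) (S : set M).

Definition homogeneous m := exists k, mod_comp k m.

Lemma mod_act0r m : mod_act m (0 : A) = 0.
Proof. by apply: (addrI (mod_act m 0)); rewrite -mod_actDr !addr0. Qed.

Lemma mod_act0l a : mod_act (0 : M) a = 0.
Proof. by apply: (addrI (mod_act 0 a)); rewrite -mod_actDl !addr0. Qed.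

Lemma mod_actBr m a x : mod_act m (a - x) = mod_act m a - mod_act m x.
Proof. by rewrite mod_actDr -scaleN1r -mod_scaleAr scaleN1r. Qed.

Lemma mod_act_sumr m (I : Type) (r : seq I) (v : I -> A) :
  mod_act m (\sum_(i <- r) v i) = \sum_(i <- r) mod_act m (v i).
Proof. exact: (big_morph _ (mod_actDr m) (mod_act0r m)). Qed.

Lemma mod_act_suml a (I : Type) (r : seq I) (v : I -> M) :
  mod_act (\sum_(i <- r) v i) a = \sum_(i <- r) mod_act (v i) a.
Proof. exact: (big_morph _ (fun m n => mod_actDl m n a) (mod_act0l a)). Qed.

Definition graded_right_ideal R : Prop :=
  graded_subspace (@alg_comp _ _ A) R /\ forall x a, R x -> R (x *a a).

Definition right_annihilator S : set A :=
  [set x | forall m, S m -> mod_act m x = 0].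

Lemma graded_right_ideal_cap R R' : graded_right_ideal R ->
  graded_right_ideal R' -> graded_right_ideal (R `&` R').
Proof.
move=> [gR RA] [gR' RA']; split; last by move=> x a [Rx R'x]; split; auto.
by apply: graded_subspace_cap => //; apply: alg_direct.
Qed.

(** If [m] is homogeneous and kills a sum of components, it sends these
    components to distinct components of the module, so it kills each. *)
Lemma right_annihilator_graded S : S `<=` homogeneous ->
  graded_right_ideal (right_annihilator S).
Proof.
move=> Shom; split; last by move=> x a xS m /xS mx0; rewrite mod_actA mx0 mod_act0l.
apply: graded_subspace_of_components; first exact: alg_direct.
  apply: subspace_intro.
  - by move=> m _; rewrite mod_act0r.
  - by move=> x y Sx Sy m Sm; rewrite mod_actDr Sx ?Sy ?addr0.
  - by move=> c x Sx m Sm; rewrite -mod_scaleAr Sx ?scaler0.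
move=> s v us vA Sv g gs m Sm; have [k mk] := Shom m Sm.
apply: (shifted_components_eq0 (mod_direct M) (k := k) us
  (v := fun g => mod_act m (v g))) => //.
  by move=> h; apply: mod_compM.
by rewrite -mod_act_sumr; apply: Sv.
Qed.

Lemma right_annihilator_homogeneous :
  right_annihilator homogeneous = module_annihilator M.
Proof.
rewrite eqEsubset; split=> a aM m; last by [].
have [s [v [_ vM ->]]] := homogeneous_decomposition (mod_direct M) m.
by rewrite mod_act_suml big1 // => g _; apply: aM; exists g.
Qed.

(** A module is spanned by its homogeneous elements, so its annihilator is the
    annihilator of a set of homogeneous elements. *)
Lemma module_annihilator_graded_ideal :
  graded_ideal_of [set: A] (module_annihilator M).
Proof.
split=> //; rewrite -right_annihilator_homogeneous.
  by have [] := right_annihilator_graded (fun m (h : homogeneous m) => h).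
rewrite right_annihilator_homogeneous => b c _ cM; split=> m.
  by rewrite mod_actA cM.
by rewrite mod_actA cM mod_act0l.
Qed.

Lemma act_image_graded_submodule m R : homogeneous m -> graded_right_ideal R ->
  graded_submodule [set mod_act m x | x in R].
Proof.
move=> [k mk] [gR RA]; have [RS [_ Rspan _]] := gR; split; last first.
  by move=> _ a [x Rx <-]; exists (x *a a); rewrite ?mod_actA //; apply: RA.
apply: graded_subspace_of_homogeneous_sums; first exact: mod_direct.
  apply: subspace_intro.
  - by exists 0; [exact: subspace0|exact: mod_act0r].
  - move=> _ _ [x Rx <-] [y Ry <-]; exists (x + y); last exact: mod_actDr.
    exact: subspaceD.
  - move=> c _ [x Rx <-]; exists (c *: x); last by rewrite mod_scaleAr.
    exact: subspaceZ.
move=> _ [x Rx <-]; have [/(_ Rx)[s [v [us vR ->]]] _] := Rspan x.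
exists G, s, (fun g => k * g)%g, (fun g => mod_act m (v g)).
split; last exact: mod_act_sumr.
move=> g _; have [Rv Av] := vR g; split; first by exists (v g).
exact: mod_compM.
Qed.

Hypothesis M_simple : graded_simple_module M.

(** This form of Schur's lemma is how simplicity of the module gets used:
    [m R] is a graded submodule, so it is everything once it is nonzero. *)
Lemma act_image_full m R a : homogeneous m -> graded_right_ideal R ->
  R a -> mod_act m a != 0 -> [set mod_act m x | x in R] = [set: M].
Proof.
move=> hm gR Ra ma; have [_ /(_ _ (act_image_graded_submodule hm gR))[E|//]] := M_simple.
have : [set mod_act m x | x in R] (mod_act m a) by exists a.
by rewrite E => /eqP; rewrite (negbTE ma).
Qed.

Hypothesis M_faithful : module_annihilator M = [set 0].

Lemma faithful_act a : a != 0 -> exists2 m, homogeneous m & mod_act m a != 0.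
Proof.
move=> a0; apply: contrapT => nm; case/eqP: a0.
suff : module_annihilator M a by rewrite M_faithful.
rewrite -right_annihilator_homogeneous => m hm; apply/eqP.
by apply: contrapT => /negP ma; apply: nm; exists m.
Qed.

(** A density argument: on finitely many homogeneous elements, every [a] acts
    like an element of any given nonzero graded ideal. *)
Lemma graded_ideal_acts_fully (I : set A) (ms : seq M) a :
  graded_ideal_of [set: A] I -> I <> [set 0] ->
  (forall m, m \in ms -> homogeneous m) ->
  exists2 c, I c & forall m, m \in ms -> mod_act m a = mod_act m c.
Proof.
move=> [_ gI IA] I0; have IS : subspace I := gI.1.
have {I0} [i Ii i0] : exists2 i, I i & i != 0.
  apply: contrapT => nI; apply: I0; rewrite eqEsubset; split=> [x Ix|_ ->].
    by apply/eqP; apply: contrapT => /negP x0; apply: nI; exists x.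
  exact: subspace0.
elim: ms => [|m ms IHms] hms; first by exists 0 => //; exact: subspace0.
have [|c Ic cP] := IHms; first by move=> n nms; apply: hms; rewrite inE nms orbT.
have hm : homogeneous m by apply: hms; rewrite inE eqxx.
pose R := right_annihilator [set n | n \in ms].
have gR : graded_right_ideal R.
  by apply: right_annihilator_graded => n nms; apply: hms; rewrite inE nms orbT.
have Rac : R (a - c) by move=> n /cP; rewrite mod_actBr => ->; rewrite subrr.
(* The error [a - c] kills [ms]; it is corrected on [m] by an element that also
   kills [ms]. *)
have [mac|mac] := eqVneq (mod_act m (a - c)) 0.
  exists c => // n; rewrite inE => /predU1P[->|/cP//].
  by apply/subr0_eq; rewrite -mod_actBr.
have mR := act_image_full hm gR Rac mac.
(* [m R] is the whole module and [I] does not kill it, so [m (R I)], and a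
   fortiori [m (R `&` I)], is nonzero and therefore also the whole module. *)
have [n hn ni] := faithful_act i0.
have [x Rx xn] : [set mod_act m x | x in R] n by rewrite mR.
have gRI : graded_right_ideal (R `&` I).
  by apply: graded_right_ideal_cap => //; split=> // y b Iy; have [] := IA b y.
have RIxi : (R `&` I) (x *a i).
  by split; [apply: gR.2|have [] := IA x i].
have mRI : [set mod_act m x | x in R `&` I] (mod_act m (a - c)).
  by rewrite (act_image_full hm gRI RIxi) // mod_actA xn.
have [d [Rd Id] md] := mRI.
exists (c + d); first exact: subspaceD.
move=> p; rewrite inE mod_actDr => /predU1P[->|pms].
  by rewrite md mod_actBr addrC subrK.
by rewrite (Rd p pms) addr0 cP.
Qed.

(** A finite algebra is separated by finitely many homogeneous elements of a
    faithful module; on these, any element agrees with an element of a given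
    nonzero graded ideal, so it belongs to that ideal. *)
Lemma faithful_simple_module_graded_simple :
  finite_set [set: A] -> graded_simple A.
Proof.
move=> /finite_seqP[sA sAE].
split; last first.
  move=> I gI; have [->|/eqP I0] := eqVneq I [set 0]; [by left|right].
  have [ms hms msP] : exists2 ms : seq M, forall m, m \in ms -> homogeneous m &
      forall a, a \in sA -> a != 0 -> exists2 m, m \in ms & mod_act m a != 0.
    elim: (sA) => [|a s [ms hms msP]]; first by exists [::].
    have [->|/faithful_act[m hm ma]] := eqVneq a 0.
      exists ms => // b; rewrite inE => /predU1P[->|/msP //].
      by rewrite eqxx.
    exists (m :: ms) => [n|b]; first by rewrite inE => /predU1P[->//|/hms].
    rewrite inE => /predU1P[-> _|/msP sb /sb[n nms nb]].
      by exists m; rewrite ?inE ?eqxx.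
    by exists n; rewrite ?inE ?nms ?orbT.
  rewrite eqEsubset; split=> // a _.
  have [c Ic ac] := graded_ideal_acts_fully a gI I0 hms.
  suff -> : a = c by [].
  apply/eqP; apply: contrapT => /negP; rewrite -subr_eq0 => /msP[].
    have : [set: A] (a - c) by []. by rewrite sAE.
  by move=> m mms; rewrite mod_actBr ac // subrr eqxx.
(* If [A] had zero product, then for [n] homogeneous with [n A] nonzero, the
   module would be [n A], which [A] kills. *)
apply: contrapT => A2.
have {}A2 x y : x *a y = 0.
  by apply/eqP; apply: contrapT => /negP xy; apply: A2; exists x, y.
have [[m [a ma]] _] := M_simple.
have : module_annihilator M a.
  rewrite -right_annihilator_homogeneous => n hn; apply/eqP; apply: contrapT => /negP na.
  have gT : graded_right_ideal [set: A].
    by split=> //; apply: graded_subspace_setT; apply: alg_direct.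
  have := act_image_full hn gT I na.
  move=> nT; have [b _ nb] : [set mod_act n x | x in [set: A]] m by rewrite nT.
  by case/eqP: ma; rewrite -nb -mod_actA A2 mod_act0r.
rewrite M_faithful => a0; case/eqP: ma; rewrite a0; exact: mod_act0r.
Qed.

End Modules.
(** * Evaluation of graded polynomials *)

Section Evaluation.
Local Open Scope fset_scope.
Local Open Scope ring_scope.
Variables (G : groupType) (F : fieldType) (A : gradedAlgType G F).
Implicit Types (a : nat * G -> A) (f : {malg F[free_word G]}) (w : free_word G).

Lemma alg_mul0l (x : A) : 0 *a x = 0.
Proof. by apply: (addrI (0 *a x)); rewrite -alg_mulDl !addr0. Qed.

Lemma alg_mul0r (x : A) : x *a 0 = 0.
Proof. by apply: (addrI (x *a 0)); rewrite -alg_mulDr !addr0. Qed.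

Lemma alg_mul_suml (x : A) (I : Type) (r : seq I) (v : I -> A) :
  (\sum_(i <- r) v i) *a x = \sum_(i <- r) v i *a x.
Proof.
exact: (big_morph (fun y => y *a x) (fun y z => alg_mulDl y z x) (alg_mul0l x)).
Qed.

Lemma alg_mul_sumr (x : A) (I : Type) (r : seq I) (v : I -> A) :
  x *a (\sum_(i <- r) v i) = \sum_(i <- r) x *a v i.
Proof. exact: (big_morph _ (alg_mulDr x) (alg_mul0r x)). Qed.

Lemma eval_polyEw a (d : {fset free_word G}) f : msupp f `<=` d ->
  eval_poly a f = \sum_(w <- d) f@_w *: eval_word a w.
Proof.
move=> fd; apply: big_fset_incl => // w _ wf.
by rewrite mcoeff_outdom // scale0r.
Qed.

Lemma eval_polyD a f g : eval_poly a (f + g) = eval_poly a f + eval_poly a g.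
Proof.
rewrite !(@eval_polyEw a (msupp f `|` msupp g)) ?msuppD_le ?fsubsetUl ?fsubsetUr //.
by rewrite -big_split; apply: eq_bigr => w _; rewrite mcoeffD scalerDl.
Qed.

Lemma eval_poly0 a : eval_poly a 0 = 0.
Proof. by rewrite /eval_poly msupp0 big_seq_fset0. Qed.

Lemma eval_polyZ a c f : eval_poly a (c *: f) = c *: eval_poly a f.
Proof.
rewrite !(@eval_polyEw a (msupp f)) ?msuppZ_le //.
by rewrite scaler_sumr; apply: eq_bigr => w _; rewrite mcoeffZ scalerA.
Qed.

Lemma eval_poly_sum a (I : Type) (r : seq I) (P : pred I) h :
  eval_poly a (\sum_(i <- r | P i) h i) = \sum_(i <- r | P i) eval_poly a (h i).
Proof. exact: (big_morph _ (eval_polyD a) (eval_poly0 a)). Qed.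

Lemma eval_polyU a c w : eval_poly a << c *g w >> = c *: eval_word a w.
Proof.
by rewrite (eval_polyEw a msuppU_le) big_seq_fset1 mcoeffUU.
Qed.

Lemma eval_wordM a u w : u != mone -> w != mone ->
  eval_word a (mmul u w) = eval_word a u *a eval_word a w.
Proof.
rewrite -!val_eqE /= fm1 /eval_word fmM.
case: (fmonom_val u) => [|x u'] //; case: (fmonom_val w) => [|y w'] // _ _ /=.
rewrite foldl_cat /=; elim/last_ind: w' => //= w' z IHw.
by rewrite !foldl_rcons IHw alg_mulA.
Qed.

Lemma free_alg_support f w : free_alg f -> w \in msupp f -> w != mone.
Proof.
by move=> f0; rewrite -mcoeff_neq0; apply: contra => /eqP ->; rewrite f0.
Qed.

(** The empty word evaluates to 0 rather than to a unit, so multiplicativity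
    requires both polynomials to have no constant term. *)
Lemma eval_polyM a f g : free_alg f -> free_alg g ->
  eval_poly a (f * g) = eval_poly a f *a eval_poly a g.
Proof.
move=> f0 g0; rewrite malgME eval_poly_sum alg_mul_suml; apply: eq_big_seq => u uf.
rewrite eval_poly_sum alg_mul_sumr; apply: eq_big_seq => w wg.
rewrite eval_polyU eval_wordM ?(free_alg_support f0 uf) ?(free_alg_support g0 wg) //.
by rewrite -alg_scaleAl -alg_scaleAr scalerA.
Qed.

Lemma eq_in_eval_word a a' w :
  {in fmonom_val w, a =1 a'} -> eval_word a w = eval_word a' w.
Proof.
rewrite /eval_word; case: (fmonom_val w) => // x w' aa'.
rewrite aa' ?mem_head //.
have {}aa' : {in w', a =1 a'} by move=> y yw; apply: aa'; rewrite inE yw orbT.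
elim/last_ind: w' aa' => //= w' z IHw aa'; rewrite !foldl_rcons.
rewrite aa' ?mem_rcons ?mem_head // IHw // => y yw.
by apply: aa'; rewrite mem_rcons inE yw orbT.
Qed.

Lemma eval_word_eq0 a w x :
  x \in fmonom_val w -> a x = 0 -> eval_word a w = 0.
Proof.
rewrite /eval_word; case: (fmonom_val w) => // y w'; rewrite inE => xw ax.
elim/last_ind: w' xw => [|w' z IHw] /=; first by rewrite orbF => /eqP <-.
rewrite foldl_rcons mem_rcons inE.
have [<- _|_ /= /IHw ->] := eqVneq x z; last exact: alg_mul0l.
by rewrite ax alg_mul0r.
Qed.

Definition word_degree w : G := foldl (fun g x => (g * x.2)%g) 1%g (fmonom_val w).

Definition homogeneous_valuation a := forall x, alg_comp x.2 (a x).

Lemma eval_word_degree a w :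
  homogeneous_valuation a -> alg_comp (word_degree w) (eval_word a w).
Proof.
move=> ah; rewrite /word_degree /eval_word; case: (fmonom_val w) => [|x w'].
  by apply: subspace0; apply: comp_subspace (alg_direct A) _.
rewrite /= mul1g; elim/last_ind: w' => //= w' z IHw.
by rewrite !foldl_rcons; apply: alg_compM.
Qed.

Lemma eval_word_subalgebra (B : set A) a w : graded_subalgebra B ->
  (forall x, B (a x)) -> B (eval_word a w).
Proof.
move=> [[BS _] BM] aB; rewrite /eval_word; case: (fmonom_val w) => [|x w'].
  exact: subspace0.
by elim/last_ind: w' => //= w' z IHw; rewrite foldl_rcons; apply: BM.
Qed.

Lemma eval_poly_subalgebra (B : set A) a f : graded_subalgebra B ->
  (forall x, B (a x)) -> B (eval_poly a f).
Proof.
move=> BA aB; have [[BS _] _] := BA; apply: subspace_sum => // w _.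
by apply: subspaceZ => //; apply: eval_word_subalgebra.
Qed.

Definition restrict_words (p : pred (free_word G)) f : {malg F[free_word G]} :=
  \sum_(w <- msupp f | p w) << f@_w *g w >>.

Lemma eval_restrict_words a p f : eval_poly a (restrict_words p f) =
  \sum_(w <- msupp f | p w) f@_w *: eval_word a w.
Proof. by rewrite eval_poly_sum; apply: eq_bigr => w _; rewrite eval_polyU. Qed.

Lemma free_alg_restrict_words p f : free_alg f -> free_alg (restrict_words p f).
Proof.
move=> f0; rewrite /free_alg /mkset /restrict_words raddf_sum big1_seq //= => w.
move=> /andP[_ /(free_alg_support f0)]; rewrite mcoeffU => /negbTE ->.
by rewrite mulr0n.
Qed.

(** The value of a polynomial at a homogeneous valuation decomposes along the
    homogeneous components of the polynomial itself. *)
Lemma eval_degree_components a f : homogeneous_valuation a ->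
  let s := undup [seq word_degree w | w <- msupp f] in
  let h g := restrict_words (fun w => word_degree w == g) f in
  (forall g, alg_comp g (eval_poly a (h g))) /\
  eval_poly a f = \sum_(g <- s) eval_poly a (h g).
Proof.
move=> ah /=; split=> [g|].
  rewrite eval_restrict_words; have cS := comp_subspace (alg_direct A) g.
  apply: subspace_sum => // w /eqP <-; apply: subspaceZ.
    exact: comp_subspace (alg_direct A) _.
  exact: eval_word_degree.
under eq_bigr => g _ do rewrite eval_restrict_words.
exact: sum_by_degree.
Qed.

Lemma free_algM f g : free_alg f -> free_alg g -> free_alg (f * g).
Proof.
rewrite /free_alg /mkset => f0 g0.
by rewrite (rmorphM (mcoeff mone)) /= f0 mul0r.
Qed.

End Evaluation.

Section SectionIdentities.
Variables (G : groupType) (F : fieldType) (A : gradedAlgType G F).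
Variable s : graded_section A.

Lemma eval_word_section (b : nat * G -> A) (b' : nat * G -> num_space s) w :
  (forall x, val (b' x) = b x) ->
  exists2 z, val z = eval_word b w &
    eval_word (A := section_alg s) (fun x => sec_pi (b' x)) w = sec_pi z.
Proof.
move=> b'E; rewrite /eval_word; case: (fmonom_val w) => [|x w'].
  by exists 0; rewrite ?num_val0 ?sec_pi0.
elim/last_ind: w' => [|w' y [z zE IHw]] /=; first by exists (b' x); rewrite ?b'E.
by exists (num_mul z (b' y)); rewrite !foldl_rcons ?num_mulE ?zE ?b'E // IHw sec_piM.
Qed.

Lemma eval_poly_section (b : nat * G -> A) (b' : nat * G -> num_space s) f :
  (forall x, val (b' x) = b x) ->
  exists2 z, val z = eval_poly b f &
    eval_poly (A := section_alg s) (fun x => sec_pi (b' x)) f = sec_pi z.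
Proof.
move=> b'E; rewrite /eval_poly.
elim: (enum_fset (msupp f)) => [|w r [z zE IHr]].
  by exists 0; rewrite !big_nil ?num_val0 ?sec_pi0.
have [y yE wE] := eval_word_section w b'E.
exists (f@_w *: y + z); rewrite !big_cons; first by rewrite num_valD num_valZ yE zE.
by rewrite IHr wE sec_piD sec_piZ.
Qed.

(** Every homogeneous valuation in [B / C] lifts to a homogeneous valuation in
    [B], so the identities of a section can be tested inside [A]. *)
Lemma section_identityP f : graded_identity (section_alg s) f <->
  free_alg f /\ forall b, homogeneous_valuation b ->
    (forall x, sec_num s (b x)) -> sec_den s (eval_poly b f).
Proof.
split=> [[f0 fs]|[f0 fs]]; split=> //.
  move=> b bh bB.
  have [|z <- zE] := @eval_poly_section b (fun x => num_mk (bB x)) f; first by [].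
  apply/sec_pi_eq0; rewrite -zE; apply: fs => x.
  by exists (num_mk (bB x)) => //=; apply: bh.
move=> a ah.
have [b' b'P] : {b' : nat * G -> num_space s &
    forall x, alg_comp x.2 (val (b' x)) /\ sec_pi (b' x) = a x}.
  apply: (@boolp.choice _ _ (fun x y => alg_comp x.2 (val y) /\ sec_pi y = a x)).
  by move=> x; have [y yg <-] := ah x; exists y.
have [|z zE] := @eval_poly_section (fun x => val (b' x)) b' f; first by [].
have -> : (fun x => sec_pi (b' x)) = a by apply/funext => x; case: (b'P x).
move=> ->; apply/sec_pi_eq0; rewrite zE; apply: fs => x; first by case: (b'P x).
exact: num_valP.
Qed.

End SectionIdentities.
(** * From graded simple to critical *)

Section SimpleImpliesCritical.
Variables (G : groupType) (F : fieldType) (A : gradedAlgType G F).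
Local Notation letter := (nat * G)%type.
Local Notation poly := {malg F[free_word G]}.
Implicit Types (K : set poly) (b e : letter -> A) (f : poly).

(** These are the graded two-sided ideals of the free algebra; being graded is
    phrased by closure under homogeneous components. *)
Definition graded_poly_ideal K : Prop :=
  [/\ K `<=` @free_alg G F, subspace K,
      forall f k, free_alg f -> K k -> K (f * k) /\ K (k * f)
    & forall k g, K k -> g \in [seq word_degree w | w <- msupp k] ->
        K (restrict_words (fun w => word_degree w == g) k)].

Lemma free_alg_subspace : subspace (@free_alg G F).
Proof.
apply: subspace_intro; rewrite /free_alg /mkset.
- exact: mcoeff0.
- by move=> f g f0 g0; rewrite mcoeffD f0 g0 addr0.
- by move=> c f f0; rewrite mcoeffZ f0 mulr0.
Qed.

Lemma free_alg_graded_poly_ideal : graded_poly_ideal (@free_alg G F).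
Proof.
split=> //; first exact: free_alg_subspace.
  by move=> f k f0 k0; split; apply: free_algM.
by move=> k g k0 _; apply: free_alg_restrict_words.
Qed.

Lemma graded_poly_ideal_cap K K' : graded_poly_ideal K ->
  graded_poly_ideal K' -> graded_poly_ideal (K `&` K').
Proof.
move=> [K0 KS KM KR] [_ KS' KM' KR']; split.
- by move=> f [/K0].
- exact: subspace_cap.
- move=> f k f0 [Kk Kk']; have [? ?] := KM f k f0 Kk.
  by have [? ?] := KM' f k f0 Kk'.
- by move=> k g [Kk Kk'] kg; split; auto.
Qed.

(** The kernel of the homomorphism from the free algebra to the section
    [s] induced by the valuation [sec_pi \o b]. *)
Definition section_kernel (s : graded_section A) b : set poly :=
  [set f | free_alg f /\ sec_den s (eval_poly b f)].

Lemma section_kernel_graded_poly_ideal (s : graded_section A) b :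
  homogeneous_valuation b -> (forall x, sec_num s (b x)) ->
  graded_poly_ideal (section_kernel s b).
Proof.
move=> bh bB; have [_ gC CM] := sec_denP s; have CS := gC.1.
have BA := sec_numP s; split; first by move=> f [].
- apply: subspace_intro.
  + by split; [exact: subspace0 free_alg_subspace|rewrite eval_poly0; exact: subspace0].
  + move=> f k [f0 fC] [k0 kC]; split; first exact: subspaceD free_alg_subspace _ _.
    by rewrite eval_polyD; apply: subspaceD.
  + move=> c f [f0 fC]; split; first exact: subspaceZ free_alg_subspace _.
    by rewrite eval_polyZ; apply: subspaceZ.
- move=> f k f0 [k0 kC].
  have [? ?] := CM _ _ (eval_poly_subalgebra f BA bB) kC.
  by split; (split; first exact: free_algM); rewrite eval_polyM.
- move=> k g [k0 kC] kg; split; first exact: free_alg_restrict_words.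
  have [kh kE] := eval_degree_components k bh; rewrite kE in kC.
  apply: (graded_component (alg_direct A) gC (undup_uniq _) kh kC).
  by rewrite mem_undup.
Qed.

Lemma eval_graded_ideal e K : homogeneous_valuation e ->
  (forall x, exists2 f, free_alg f & eval_poly e f = x) ->
  graded_poly_ideal K -> graded_ideal_of [set: A] [set eval_poly e f | f in K].
Proof.
move=> eh esurj [K0 KS KM KR]; split=> //; last first.
  move=> x _ _ [k Kk <-]; have [f f0 <-] := esurj x.
  have [Kfk Kkf] := KM f k f0 Kk; have k0 := K0 _ Kk; split.
    by exists (f * k); [exact: Kfk|exact: eval_polyM].
  by exists (k * f); [exact: Kkf|exact: eval_polyM].
apply: graded_subspace_of_homogeneous_sums; first exact: alg_direct.
  apply: subspace_intro.
  - by exists 0; [exact: subspace0|exact: eval_poly0].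
  - move=> _ _ [f Kf <-] [k Kk <-]; exists (f + k); last exact: eval_polyD.
    exact: subspaceD.
  - move=> c _ [f Kf <-]; exists (c *: f); last exact: eval_polyZ.
    exact: subspaceZ.
move=> _ [f Kf <-]; have [fh fE] := eval_degree_components f eh.
eexists G, _, id, _; split; last exact: fE.
move=> g; rewrite mem_undup => gf; split; last exact: fh.
by exists (restrict_words (fun w => word_degree w == g) f) => //; apply: KR.
Qed.

(** A graded simple algebra is graded prime: a finite intersection of graded
    ideals of the free algebra, each mapped onto [A], contains their products
    and is thus mapped onto a nonzero ideal. *)
Lemma eval_ideal_inter_onto e (J : eqType) (r : seq J) (K : J -> set poly) :
  graded_simple A -> homogeneous_valuation e ->
  (forall x, exists2 f, free_alg f & eval_poly e f = x) ->
  (forall j, j \in r -> graded_poly_ideal (K j) /\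
     [set eval_poly e f | f in K j] = [set: A]) ->
  forall x, exists2 f, free_alg f /\ (forall j, j \in r -> K j f) &
    eval_poly e f = x.
Proof.
move=> [[x0 [y0 xy0]] A_simple] eh esurj KP.
suff [N [NK NI NT]] : exists N, [/\ forall f, N f -> forall j, j \in r -> K j f,
    graded_poly_ideal N & [set eval_poly e f | f in N] = [set: A]].
  move=> x; have [f Nf <-] : [set eval_poly e f | f in N] x by rewrite NT.
  by exists f => //; split; [have [+ _ _ _] := NI; apply|exact: NK].
elim: r KP => [_|j r IHr KP].
  exists (@free_alg G F); split=> //; first exact: free_alg_graded_poly_ideal.
  by rewrite eqEsubset; split=> // x _; have [f f0 <-] := esurj x; exists f.
have [|N [NK NI NT]] := IHr; first by move=> i ir; apply: KP; rewrite inE ir orbT.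
have [KI KT] := KP j (mem_head _ _).
have NKI := graded_poly_ideal_cap NI KI.
exists (N `&` K j); split=> //.
  by move=> f [/NK Nf Kf] i; rewrite inE => /predU1P[->|/Nf].
have [E|//] := A_simple _ (eval_graded_ideal eh esurj NKI).
case/eqP: xy0.
have [f Nf <-] : [set eval_poly e f | f in N] x0 by rewrite NT.
have [k Kk <-] : [set eval_poly e f | f in K j] y0 by rewrite KT.
have [N0 _ NM _] := NI; have [K0 _ KM _] := KI.
suff : [set eval_poly e f | f in N `&` K j] (eval_poly e f *a eval_poly e k).
  by rewrite E.
rewrite -eval_polyM; [|exact: N0|exact: K0].
exists (f * k); last by [].
split; first exact: (NM k f (K0 _ Kk) Nf).2.
exact: (KM f k (N0 _ Nf) Kk).1.
Qed.

(** Otherwise the kernel would be contained in the kernel of [eval_poly e], so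
    that [A] would be a quotient of a subalgebra of the section; counting
    elements, this forces the section to be [A] itself. *)
Lemma section_kernel_evaluates_onto e (s : graded_section A) b :
  finite_set [set: A] -> graded_simple A -> homogeneous_valuation e ->
  (forall x, exists2 f, free_alg f & eval_poly e f = x) ->
  proper_section s -> homogeneous_valuation b -> (forall x, sec_num s (b x)) ->
  [set eval_poly e f | f in section_kernel s b] = [set: A].
Proof.
move=> /finite_seqP[sA0 sAE0] [_ A_simple] eh esurj s_proper bh bB.
have KI := section_kernel_graded_poly_ideal bh bB.
have [K0|//] := A_simple _ (eval_graded_ideal eh esurj KI).
exfalso; apply: s_proper.
(* [phi x] represents the value in the section of a polynomial whose value at
   [e] is [x]. *)
have [p pP] : {p : A -> poly & forall x, free_alg (p x) /\ eval_poly e (p x) = x}.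
  apply: (@boolp.choice _ _ (fun x f => free_alg f /\ eval_poly e f = x)).
  by move=> x; have [f f0 fx] := esurj x; exists f.
have kerE f : section_kernel s b f -> eval_poly e f = 0.
  move=> Kf; suff : [set eval_poly e f | f in section_kernel s b] (eval_poly e f).
    by rewrite K0.
  by exists f.
have CS : subspace (sec_den s) by have [_ []] := sec_denP s.
pose phi x := eval_poly b (p x).
have phi_inj : injective phi.
  move=> x y xy; have [[px0 px] [py0 py]] := (pP x, pP y).
  rewrite -px -py; apply/subr0_eq.
  rewrite -[X in _ - X]scale1r -scaleNr -eval_polyZ -eval_polyD; apply: kerE.
  split.
    apply: subspaceD free_alg_subspace _ _ => //.
    exact: subspaceZ free_alg_subspace _.
  rewrite eval_polyD eval_polyZ [eval_poly b (p x)]xy scaleN1r subrr.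
  exact: subspace0.
have phi_surj y : exists x, phi x = y.
  pose sA := undup sA0.
  have sAP x : x \in sA.
    by rewrite mem_undup; have : [set: A] x by []; rewrite sAE0.
  have [|||_ /(_ y)] := @uniq_min_size _ (map phi sA) sA.
  - by rewrite map_inj_uniq // undup_uniq.
  - by move=> x _; apply: sAP.
  - by rewrite size_map.
  - by rewrite sAP => /mapP[x _ ->]; exists x.
(* A polynomial with value in [sec_den s] lies in the kernel. *)
have phi0 z : sec_den s z -> phi 0 = z.
  move=> Cz; have [x xz] := phi_surj z; rewrite -xz; congr phi.
  have [px0 px] := pP x; rewrite -px; apply/esym/kerE; split=> //.
  by rewrite -/(phi x) xz.
have C0 := subspace0 CS; split; apply/seteqP; split=> //.
- move=> y _; have [x <-] := phi_surj y.
  by apply: eval_poly_subalgebra bB; apply: sec_numP.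
- by move=> y Cy; rewrite /= -(phi0 y Cy) (phi0 0).
- by move=> _ ->.
Qed.

(** The kernel of a section depends only on its denominator and on a valuation
    in [A]; with finitely many letters there are finitely many such pairs. *)
Lemma finite_codes (X : seq letter) : finite_set [set: A] ->
  exists (J : finType) (C : J -> set A) (v : J -> letter -> A),
    forall D b, (forall x, x \notin X -> b x = 0) ->
    exists2 j, C j = D & v j = b.
Proof.
move=> /finite_seqP[sA sAE].
have sAP x : x \in sA by have : [set: A] x by []; rewrite sAE.
pose sub x : seq_sub sA := SeqSub (sAP x).
pose J : finType := ({set seq_sub sA} * {ffun seq_sub X -> seq_sub sA})%type.
pose C (j : J) : set A := [set x | sub x \in j.1]%classic.
pose v (j : J) x := if insub x is Some y then val (j.2 y) else 0.
exists J, C, v.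
move=> D b bX; exists ([set t | `[< D (val t) >]]%SET, [ffun y => sub (b (val y))]).
  by apply/seteqP; split=> x; rewrite /C /= inE => /asboolP.
apply/funext => x; rewrite /v /=; case: insubP => [y _ <-|/bX ->//].
by rewrite ffunE.
Qed.

(** The letter [(i, g)] is sent to the [i]-th element of [A] when that element
    has degree [g]; finitely many degrees occur because [A] is finite. *)
Lemma finite_surjective_valuation : finite_set [set: A] ->
  exists (X : seq letter) e, [/\ homogeneous_valuation e,
    forall x, x \notin X -> e x = 0 &
    forall x, exists2 f, free_alg f & eval_poly e f = x].
Proof.
move=> /finite_seqP[sA sAE].
have sAP x : x \in sA by have : [set: A] x by []; rewrite sAE.
have [S SP] : exists S : seq G, forall x, x \in sA -> exists (s : seq G) (v : G -> A),
    [/\ {subset s <= S}, forall g, alg_comp g (v g) & x = \sum_(g <- s) v g].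
  elim: {sAE sAP} sA => [|y r [S SP]]; first by exists [::].
  have [s [v [_ vA yE]]] := homogeneous_decomposition (alg_direct A) y.
  exists (s ++ S) => x; rewrite inE => /predU1P[->|/SP[t [u [tS uA xE]]]].
    by exists s, v; split=> // g gs; rewrite mem_cat gs.
  by exists t, u; split=> // g /tS gS; rewrite mem_cat gS orbT.
pose X : seq letter := [seq (i, g) | i <- iota 0 (size sA), g <- S].
pose e (x : letter) : A :=
  if (x \in X) && `[< alg_comp x.2 (nth 0 sA x.1) >] then nth 0 sA x.1 else 0.
exists X, e; split.
- move=> x; rewrite /e; case: ifP => [/andP[_ /asboolP]//|_].
  by apply: subspace0; apply: comp_subspace (alg_direct A) _.
- by move=> x /negbTE xX; rewrite /e xX.
move=> x; have [s [v [sS vA ->]]] := SP x (sAP x).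
pose l g : free_word G := fmu (index (v g) sA, g).
exists (\sum_(g <- s) << l g >>).
  rewrite /free_alg /mkset raddf_sum big1 // => g _ /=.
  rewrite mcoeffU (_ : l g == mone = false) //.
  by rewrite -val_eqE /= fmU fm1.
rewrite eval_poly_sum; apply: eq_big_seq => g gs.
rewrite eval_polyU scale1r /eval_word fmU /= /e /=.
rewrite nth_index // (asboolT (vA g)) andbT allpairs_f ?sS //.
by rewrite mem_iota index_mem sAP.
Qed.

Lemma eval_restrict_letters (X : seq letter) b f :
  eval_poly b (restrict_words (fun w => all [in X] (fmonom_val w)) f) =
  eval_poly (fun x => if x \in X then b x else 0) f.
Proof.
rewrite eval_restrict_words big_mkcond; apply: eq_bigr => w _; case: ifP.
  move=> /allP wX; congr (_ *: _); apply: eq_in_eval_word => x /wX.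
  by move=> /= ->.
move=> /negbT/allPn[x xw /negbTE /= xX].
by rewrite (eval_word_eq0 xw) ?scaler0 ?xX.
Qed.

(** The kernels of all proper sections in finitely many letters form a finite
    family, so their intersection contains a polynomial with nonzero value in
    [A]. *)
Lemma graded_simple_critical :
  finite_set [set: A] -> graded_simple A -> critical A.
Proof.
move=> A_fin A_simple; split=> // A_var.
have [X [e [eh eX esurj]]] := finite_surjective_valuation A_fin.
have [J [C [v codeP]]] := finite_codes X A_fin.
pose valid (s : graded_section A) b := [/\ proper_section s,
  homogeneous_valuation b & forall x, sec_num s (b x)].
pose good j := exists s, valid s (v j) /\ sec_den s = C j.
pose K j : set poly := [set f | free_alg f /\ C j (eval_poly (v j) f)].
have KP j : j \in [seq j <- enum J | `[< good j >]] -> graded_poly_ideal (K j) /\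
    [set eval_poly e f | f in K j] = [set: A].
  rewrite mem_filter => /andP[/asboolP[s [[s_proper vh vB] sC]] _].
  rewrite /K -sC; split; first exact: section_kernel_graded_poly_ideal.
  exact: section_kernel_evaluates_onto.
have [[x0 [y0 xy0]] _] := A_simple.
have [f [f0 fK] fxy] := eval_ideal_inter_onto A_simple eh esurj KP (x0 *a y0).
(* Dropping the words with letters outside [X] makes [f] vanish at all
   valuations of the sections, and does not change its value at [e]. *)
pose f' := restrict_words (fun w => all [in X] (fmonom_val w)) f.
case/eqP: xy0; rewrite -fxy.
have <- : eval_poly e f' = eval_poly e f.
  rewrite eval_restrict_letters; congr (eval_poly _ f); apply/funext => x.
  by case: ifPn => // /eX.
suff /A_var[_ ->] : common_identities (proper_sections A) f' by [].
have f'0 : free_alg f' by apply: free_alg_restrict_words.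
split=> // _ [s s_proper ->]; apply/section_identityP; split=> // b bh bB.
rewrite eval_restrict_letters.
have [|j sC vb] := codeP (sec_den s) (fun x => if x \in X then b x else 0).
  by move=> x /negbTE ->.
rewrite -sC -vb; suff /fK[//] : j \in [seq j <- enum J | `[< good j >]].
rewrite mem_filter mem_enum andbT; apply/asboolP; exists s; split=> //.
rewrite vb; split=> // x; case: ifP => // _; apply: subspace0.
  exact: comp_subspace (alg_direct A) _.
by have [[]] := sec_numP s.
Qed.

End SimpleImpliesCritical.

(** * Critical algebras *)

Section CriticalImpliesSimple.
Variables (G : groupType) (F : fieldType) (A : gradedAlgType G F).

Lemma setT_graded_subalgebra : graded_subalgebra [set: A].
Proof. by split=> //; apply: graded_subspace_setT; apply: alg_direct. Qed.

(** A critical algebra is monolithic: a nonzero value [h] of an identity of all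
    proper sections vanishes in every proper quotient [A / I]. *)
Lemma critical_monolith : critical A -> exists2 h : A, h != 0 &
  forall I, graded_ideal_of [set: A] I -> I <> [set 0] -> I h.
Proof.
move=> [_ A_var]; apply: contrapT => noh; apply: A_var => f [f0 fs].
split=> // a ah; apply/eqP; apply: contrapT => /negP h0; apply: noh.
exists (eval_poly a f) => // I gI I0.
pose s := GradedSection setT_graded_subalgebra gI.
have /fs/section_identityP[_ sI] : proper_sections A (section_alg s).
  by exists s => // -[_ /I0].
exact: sI.
Qed.

(** Since the radical is zero, some graded simple module is not killed by the
    element [h] of the monolith; its annihilator is then zero. *)
Lemma critical_graded_simple :
  finite_set [set: A] -> graded_jacobson_radical A = [set 0] ->
  critical A -> graded_simple A.
Proof.
move=> A_fin A_ss /critical_monolith[h h0 hI].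
have [M M_simple Mh] : exists2 M : gradedModType A,
    graded_simple_module M & ~ module_annihilator M h.
  apply: contrapT => noM; case/eqP: h0.
  suff : graded_jacobson_radical A h by rewrite A_ss.
  by move=> M M_simple; apply: contrapT => Mh; apply: noM; exists M.
apply: (faithful_simple_module_graded_simple M_simple) => //.
apply: contrapT => M0; apply: Mh; apply: hI => //.
exact: module_annihilator_graded_ideal.
Qed.

End CriticalImpliesSimple.

Theorem proposition3p6 (G : groupType) (F : fieldType)
    (A : gradedAlgType G F)
    (A_finite : finite_set [set: A])
    (A_semisimple : graded_jacobson_radical A = [set 0]) :
  critical A <-> graded_simple A.
Proof.
split; first exact: critical_graded_simple.
exact: graded_simple_critical.
Qed.
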